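(* Let $M$, $C$, $W$, $P$, $Q$ and the sequences $\mathbf{x}^{\langle k\rangle}$, $\mathbf{y}^{\langle k\rangle}$ be as in the context. Then the sequences $(\mathbf{x}^{\langle k\rangle})_{k\ge 0}$ and $(\mathbf{y}^{\langle k\rangle})_{k\ge 0}$ converge, as $k\to\infty$, to limits $\mathbf{x}^\star\in\mathbb{R}^m$ and $\mathbf{y}^\star\in\mathbb{R}^n$ respectively. Moreover, $\mathbf{x}^\star$ is a principal eigenvector of $P = W(I+C^T)M^T$, and $\mathbf{y}^\star$ is a principal eigenvector of $Q=(I+C^T)M^TW$. Further, both $\mathbf{x}^\star$ and $\mathbf{y}^\star$ have all components non-negative and are non-zero (their components sum to $1$).
   Context: There are $m$ authors $a_1,\dots,a_m$ and $n$ papers $p_1,\dots,p_n$. The publication matrix $M=(m_{ij})$ is the $m\times n$ $0$-$1$ matrix with $m_{ij}=1$ iff author $a_i$ wrote paper $p_j$; every paper has at least one author, i.e. $\sum_{i=1}^m m_{ij}\ge 1$ for every $j$. The citation matrix $C=(c_{jk})$ is the $n\times n$ $0$-$1$ matrix with $c_{jk}=1$ iff paper $p_j$ cites paper $p_k$; the directed citation graph (edge $p_j\to p_k$ iff $c_{jk}=1$) has no directed cycles. The weight matrix $W=(w_{ij})$ is the $m\times n$ matrix with $w_{ij}=m_{ij}/\sum_{l=1}^m m_{lj}$. $I$ denotes the $n\times n$ identity matrix. Set $P=W(I+C^T)M^T$ (an $m\times m$ non-negative matrix) and $Q=(I+C^T)M^TW$ (an $n\times n$ non-negative matrix). Let $\mathbf{x}^{\langle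 0\rangle}=\mathbf{1}\in\mathbb{R}^m$ and $\mathbf{y}^{\langle 0\rangle}=\mathbf{1}\in\mathbb{R}^n$ be all-ones vectors, and for $k\ge 0$ let the (normalized) author and paper score vectors be $\mathbf{x}^{\langle k\rangle}=P^k\mathbf{x}^{\langle 0\rangle}/\|P^k\mathbf{x}^{\langle 0\rangle}\|_1$ and $\mathbf{y}^{\langle k\rangle}=Q^k\mathbf{y}^{\langle 0\rangle}/\|Q^k\mathbf{y}^{\langle 0\rangle}\|_1$, so that each vector has non-negative entries summing to $1$ (this corresponds to iterating the update rules $\mathbf{x}\leftarrow W\mathbf{y}$, $\mathbf{y}\leftarrow M^T\mathbf{x}$, $\mathbf{y}\leftarrow (I+C^T)\mathbf{y}$ and normalizing each iterate to sum $1$). A principal eigenvector of a square non-negative matrix $A$ is an eigenvector of $A$ associated with an eigenvalue of maximal modulus (the spectral radius of $A$). *)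

(* Defs.v *)
From Stdlib Require Import Reals Lra Lia Arith.
Open Scope R_scope.

Fixpoint sumR (d : nat) (f : nat -> R) : R :=
  match d with
  | O => 0
  | S d' => sumR d' f + f d'
  end.

(* Vectors are nat -> R (only indices < dimension matter);
   matrices are nat -> nat -> R (entry (i,j)). *)
Definition b2R (b : bool) : R := if b then 1 else 0.

Definition matmul (d : nat) (A B : nat -> nat -> R) : nat -> nat -> R :=
  fun i k => sumR d (fun j => A i j * B j k).

Definition matvec (d : nat) (A : nat -> nat -> R) (v : nat -> R) : nat -> R :=
  fun i => sumR d (fun j => A i j * v j).

Fixpoint matpowvec (d : nat) (A : nat -> nat -> R) (k : nat) (v : nat -> R) : nat -> R :=
  match k with
  | O => v
  | S k' => matvec d A (matpowvec d A k' v)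
  end.

Definition ones : nat -> R := fun _ => 1.

Definition normalize1 (d : nat) (v : nat -> R) : nat -> R :=
  fun i => v i / sumR d (fun j => Rabs (v j)).

Definition Mmat (Mb : nat -> nat -> bool) : nat -> nat -> R :=
  fun i j => b2R (Mb i j).
Definition MTmat (Mb : nat -> nat -> bool) : nat -> nat -> R :=
  fun j i => b2R (Mb i j).
Definition Wmat (m : nat) (Mb : nat -> nat -> bool) : nat -> nat -> R :=
  fun i j => b2R (Mb i j) / sumR m (fun l => b2R (Mb l j)).
Definition ICTmat (Cb : nat -> nat -> bool) : nat -> nat -> R :=
  fun j k => (if Nat.eqb j k then 1 else 0) + b2R (Cb k j).

Definition Pmat (m n : nat) (Mb Cb : nat -> nat -> bool) : nat -> nat -> R :=
  matmul n (matmul n (Wmat m Mb) (ICTmat Cb)) (MTmat Mb).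
Definition Qmat (m n : nat) (Mb Cb : nat -> nat -> bool) : nat -> nat -> R :=
  matmul m (matmul n (ICTmat Cb) (MTmat Mb)) (Wmat m Mb).

(* Directed citation graph on papers 0..n-1 has no directed cycle
   (a self-loop c_jj = 1 counts as a cycle of length 1). *)
Definition acyclic (n : nat) (Cb : nat -> nat -> bool) : Prop :=
  forall (L : nat) (p : nat -> nat),
    (0 < L)%nat ->
    (forall t, (t <= L)%nat -> (p t < n)%nat) ->
    (forall t, (t < L)%nat -> Cb (p t) (p (S t)) = true) ->
    p L <> p 0%nat.

(* a + i b is a (complex) eigenvalue of the real d x d matrix A:
   there is a nonzero complex vector u + i v with A(u+iv) = (a+ib)(u+iv). *)
Definition is_eigenvalueC (d : nat) (A : nat -> nat -> R) (a b : R) : Prop :=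
  exists u v : nat -> R,
    (exists i, (i < d)%nat /\ (u i <> 0 \/ v i <> 0)) /\
    (forall i, (i < d)%nat ->
       matvec d A u i = a * u i - b * v i /\
       matvec d A v i = b * u i + a * v i).

(* x is a principal eigenvector of A: an eigenvector of A whose eigenvalue
   has maximal modulus among all (complex) eigenvalues of A.
   (A real nonzero eigenvector of a real matrix has a real eigenvalue.) *)
Definition principal_eigenvector (d : nat) (A : nat -> nat -> R) (x : nat -> R) : Prop :=
  exists lam : R,
    (exists i, (i < d)%nat /\ x i <> 0) /\
    (forall i, (i < d)%nat -> matvec d A x i = lam * x i) /\
    (forall a b, is_eigenvalueC d A a b -> sqrt (a * a + b * b) <= Rabs lam).

Definition xseq (m n : nat) (Mb Cb : nat -> nat -> bool) (k : nat) : nat -> R :=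
  normalize1 m (matpowvec m (Pmat m n Mb Cb) k ones).
Definition yseq (m n : nat) (Mb Cb : nat -> nat -> bool) (k : nat) : nat -> R :=
  normalize1 n (matpowvec n (Qmat m n Mb Cb) k ones).

(* Main.v *)
(** Write [|v|] for the vector of moduli.  If [u >= 0] is nonzero and
    [u A >= t u], then some eigenvalue of the non-negative matrix [A] has
    modulus at least [t]: otherwise [u A^k = o(t^k)], whereas [u A^k >= t^k u]
    (Collatz-Wielandt).

    [P] and [Q] are non-negative matrices in which a zero diagonal entry occurs
    only in a zero row.  Let [d > 0] be a lower bound of the nonzero diagonal
    entries of their transpose [A], and let [x] be an eigenvalue of maximal
    modulus, with [v A = x v].  Taking moduli in [v (A - d) = (x - d) v] gives
    [|v| A >= (d + |x - d|) |v|], hence [d + |x - d| <= |x|], hence [x = |x|].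
    So [p = |x|] is the only eigenvalue of maximal modulus.

    Split the starting vector along the generalised eigenspace of [p] and its
    invariant complement.  The second part contributes [o(p^k)]; the first one,
    [w], contributes [\sum_(j <= D) 'C(k, j) p^(k - j) w (A - p)^j], dominated
    by its last term.  Since [w (A - p)^D] is an eigenvector for [p], the
    normalized iterates converge to an eigenvector for [p]. *)

Require Import Defs.
From Stdlib Require Import Reals.
From mathcomp Require Import ssreflect.
From mathcomp Require all_boot all_order all_algebra.
From mathcomp Require reals complex Rstruct ring lra.
From mathcomp Require classical_sets functions topology normedtype sequences.
Open Scope R_scope.

Definition has_authors (m n : nat) (Mb : nat -> nat -> bool) : Prop :=
  forall j, (j < n)%nat -> exists i, (i < m)%nat /\ Mb i j = true.

Definition score_limit (d : nat) (A : nat -> nat -> R) (z : nat -> R) : Prop :=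
  (forall i, (i < d)%nat ->
     Un_cv (fun k => normalize1 d (matpowvec d A k ones) i) (z i)) /\
  principal_eigenvector d A z /\
  (forall i, (i < d)%nat -> 0 <= z i) /\
  sumR d z = 1.

Module PowerIteration.
Import all_boot all_order all_algebra reals complex ring lra.
Import classical_sets functions topology normedtype sequences.
Import Order.TTheory GRing.Theory Num.Theory numFieldNormedType.Exports Normc.
Set Implicit Arguments.
Unset Strict Implicit.
Unset Printing Implicit Defensive.
Local Open Scope classical_set_scope.
Local Open Scope ring_scope.

Local Notation toC := (real_complex _).
Local Notation abs := (map_mx (@normc _)).

Section Sequences.
Variable R : archiRealFieldType.

Lemma cvg0_contraction (q : R) (a b : R ^nat) : 0 <= q < 1 ->
  (forall k, 0 <= a k) -> (forall k, a k.+1 <= q * a k + b k) ->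
  b @ \oo --> 0 -> a @ \oo --> 0.
Proof.
move=> /andP[q_ge0 q_lt1] a_ge0 a_rec b_cvg0; apply/cvgr0Pnorm_lt => e e_gt0.
have half_gt0 : 0 < e / 2 by rewrite divr_gt0.
have [N _ b_small] : \forall k \near \oo, b k < e / 2 * (1 - q).
  by apply: (cvgr_lt _ b_cvg0); rewrite mulr_gt0 // subr_gt0.
have a_bound j : a (j + N)%N <= q ^+ j * a N + e / 2.
  elim: j => [|j IHj]; first by rewrite mul1r lerDl ltW.
  apply: le_trans (a_rec _) _.
  have := b_small (j + N)%N (leq_addl _ _); have := ler_wpM2l q_ge0 IHj.
  by rewrite exprS; lra.
have head_cvg0 : (fun j => q ^+ j * a N) @ \oo --> 0.
  rewrite -[0](mul0r (a N)); apply: cvgMr_tmp.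
  by apply: cvg_expr; rewrite ger0_norm.
have [M _ head_small] := cvgr_lt _ head_cvg0 _ half_gt0.
exists (M + N)%N => //= k le_MNk; rewrite ger0_norm //.
have le_Nk : (N <= k)%N by rewrite (leq_trans (leq_addl M N)).
have := a_bound (k - N)%N; rewrite subnK // => /le_lt_trans; apply.
have := head_small (k - N)%N; rewrite /= leq_subRL // addnC le_MNk.
by move=> /(_ isT); lra.
Qed.

Lemma cvg_bin_ratioS l :
  (fun k => 'C(k, l)%:R / 'C(k, l.+1)%:R : R) @ \oo --> 0.
Proof.
have harmonic_cvg0 : (fun k => l.+1%:R * harmonic k) @ \oo --> (0 : R).
  by rewrite -[0](mulr0 l.+1%:R); apply: cvgMl_tmp; exact: cvg_harmonic.
rewrite -(cvg_shiftn l.+1); apply: cvg_trans harmonic_cvg0.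
apply: near_eq_cvg; apply: nearW => k; rewrite /harmonic /=.
have bin_neq0 : 'C(k + l.+1, l.+1)%:R != 0 :> R.
  by rewrite pnatr_eq0 -lt0n bin_gt0 leq_addl.
apply/eqP; rewrite eqr_div ?bin_neq0 ?pnatr_eq0 // -!natrM.
by rewrite mul_bin_left addnS subSn ?leq_addl // addnK mulnC eqxx.
Qed.

Lemma cvg_bin_ratio j D : (j <= D)%N ->
  (fun k => 'C(k, j)%:R / 'C(k, D)%:R : R) @ \oo --> ((j == D)%:R : R).
Proof.
move=> /subnKC <-; elim: (D - j)%N => [|e IHe].
  rewrite addn0 eqxx; apply: cvg_near_cst; near=> k.
  rewrite divff // pnatr_eq0 -lt0n bin_gt0.
  by near: k; exact: nbhs_infty_ge.
rewrite addnS ltn_eqF ?ltnS ?leq_addr //= mulr0n.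
rewrite -(mulr0 (j == (j + e)%N)%:R).
apply: cvg_trans (cvgM IHe (cvg_bin_ratioS (j + e))).
apply: near_eq_cvg; near=> k; rewrite /= mulrA divfK //.
rewrite pnatr_eq0 -lt0n bin_gt0.
by near: k; exact: nbhs_infty_ge.
Unshelve. all: by end_near. Qed.

End Sequences.

Section EntrywiseOrder.
Variable R : numDomainType.

Definition lemx m n (A B : 'M[R]_(m, n)) := forall i j, A i j <= B i j.

Lemma lemx0P m n (A : 'M[R]_(m, n)) : lemx 0 A <-> forall i j, 0 <= A i j.
Proof. by split=> A_ge0 i j; have := A_ge0 i j; rewrite mxE. Qed.

Lemma lemx_trans m n (A B C : 'M[R]_(m, n)) : lemx A B -> lemx B C -> lemx A C.
Proof. by move=> AB BC i j; exact: le_trans (AB i j) (BC i j). Qed.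

Lemma lemx_scale m n (t : R) (A B : 'M[R]_(m, n)) :
  0 <= t -> lemx A B -> lemx (t *: A) (t *: B).
Proof. by move=> t_ge0 AB i j; rewrite !mxE ler_wpM2l. Qed.

Lemma lemx_mulr m n p (A B : 'M[R]_(m, n)) (C : 'M_(n, p)) :
  lemx 0 C -> lemx A B -> lemx (A *m C) (B *m C).
Proof.
move=> /lemx0P C_ge0 AB i j; rewrite !mxE; apply: ler_sum => k _.
by rewrite ler_wpM2r.
Qed.

Lemma lemx0_mul_pow m n (A : 'M[R]_n.+1) (B : 'M[R]_(m, n.+1)) k :
  lemx 0 A -> lemx 0 B -> lemx 0 (B *m A ^+ k).
Proof.
move=> A_ge0 B_ge0; elim: k => [|k IHk]; first by rewrite mulmx1.
by rewrite exprSr -mulmxE mulmxA -(mul0mx _ A); exact: lemx_mulr.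
Qed.

Lemma supereigen_pow n (A : 'M[R]_n.+1) (u v : 'rV_n.+1) (t : R) k :
  lemx 0 A -> 0 <= t -> lemx (t *: u) (u *m A) -> lemx u v ->
  lemx (t ^+ k *: u) (v *m A ^+ k).
Proof.
move=> A_ge0 t_ge0 tu_le uv; elim: k => [|k IHk].
  by rewrite scale1r mulmx1.
rewrite !exprSr -mulmxE mulmxA -scalerA.
apply: lemx_trans (lemx_mulr A_ge0 IHk); rewrite -scalemxAl.
by apply: lemx_scale => //; exact: exprn_ge0.
Qed.

Lemma nneg_row_neq0 n (u : 'rV[R]_n) :
  lemx 0 u -> u != 0 -> exists i, 0 < u 0 i.
Proof.
move=> /lemx0P u_ge0 /rV0Pn[j uj_neq0]; exists j.
by rewrite lt0r uj_neq0 u_ge0.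
Qed.

End EntrywiseOrder.

Lemma exists_pos_lower_bound (R : realDomainType) (I : finType) (P : pred I)
    (f : I -> R) :
  (forall i, P i -> 0 < f i) -> exists2 c, 0 < c & forall i, P i -> c <= f i.
Proof.
move=> f_gt0; exists (\big[Num.min/1]_(i | P i) f i).
  by apply/bigmin_gtP; split.
by move=> i Pi; exact: bigmin_le_cond.
Qed.

Lemma exists_scale_le (R : realFieldType) n (u v : 'rV[R]_n) :
  (forall i, 0 < v 0 i) -> exists2 c, 0 < c & lemx (c *: u) v.
Proof.
move=> v_gt0.
have [c c_gt0 c_le] := exists_pos_lower_bound (P := fun i => 0 < u 0 i)
  (f := fun i => v 0 i / u 0 i) (fun i ui_gt0 => divr_gt0 (v_gt0 i) ui_gt0).
exists c => // i j; rewrite (ord1 i) mxE.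
have [uj_gt0|uj_le0] := ltP 0 (u 0 j); first by rewrite -ler_pdivlMr // c_le.
by rewrite (le_trans _ (ltW (v_gt0 j))) // pmulr_rle0.
Qed.

Section NormalizeL1.
Variables (R : realFieldType) (n : nat).
Implicit Type v : 'rV[R]_n.

Definition normalize_l1 v : 'rV[R]_n := (\sum_i `|v 0 i|)^-1 *: v.

Lemma sum_norm_gt0 v : v != 0 -> 0 < \sum_i `|v 0 i|.
Proof.
case/rV0Pn=> i vi_neq0; rewrite (bigD1 i) //= ltr_pwDl ?normr_gt0 //.
exact: sumr_ge0.
Qed.

Lemma normalize_l1_ge0 v : lemx 0 v -> lemx 0 (normalize_l1 v).
Proof.
move=> /lemx0P v_ge0; apply/lemx0P => i j.
by rewrite mxE mulr_ge0 ?invr_ge0 ?sumr_ge0.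
Qed.

Lemma sum_normalize_l1 v : lemx 0 v -> v != 0 ->
  \sum_i normalize_l1 v 0 i = 1.
Proof.
move=> /lemx0P v_ge0 /sum_norm_gt0 sum_gt0.
rewrite (eq_bigr (fun i => (\sum_j `|v 0 j|)^-1 * `|v 0 i|)) => [|i _].
  by rewrite -mulr_sumr mulVf ?gt_eqF.
by rewrite mxE ger0_norm.
Qed.

Lemma normalize_l1Z (c : R) v : 0 < c -> normalize_l1 (c *: v) = normalize_l1 v.
Proof.
move=> c_gt0; rewrite /normalize_l1.
under eq_bigr => i _ do rewrite mxE normrM (gtr0_norm c_gt0).
by rewrite -mulr_sumr scalerA invfM mulrAC mulVf ?mul1r ?gt_eqF.
Qed.

Lemma cvg_normalize_l1 (u : nat -> 'rV[R]_n) v : v != 0 ->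
  (forall i, (fun k => u k 0 i) @ \oo --> v 0 i) ->
  forall i, (fun k => normalize_l1 (u k) 0 i) @ \oo --> normalize_l1 v 0 i.
Proof.
move=> /sum_norm_gt0 sum_gt0 u_cvg i; rewrite mxE.
under eq_cvg do rewrite mxE.
apply: cvgM; last exact: u_cvg.
apply: cvgV; first by rewrite gt_eqF.
apply: cvg_big => [|j _]; first exact: add_continuous.
by apply: cvg_norm; exact: u_cvg.
Qed.

End NormalizeL1.

Section ComplexModulus.
Variable R : rcfType.

Lemma normc_ge0 (x : R[i]) : 0 <= normc x.
Proof. by case: x => a b; exact: sqrtr_ge0. Qed.

Lemma normc_eq0 (x : R[i]) : (normc x == 0) = (x == 0).
Proof. by apply/eqP/eqP => [/eq0_normc|->] //; rewrite normc0. Qed.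

Lemma normc_real (x : R) : normc (toC x) = `|x|.
Proof. by rewrite /= expr0n addr0 sqrtr_sqr. Qed.

Lemma normc_sum (I : Type) (s : seq I) (F : I -> R[i]) :
  normc (\sum_(i <- s) F i) <= \sum_(i <- s) normc (F i).
Proof. exact: (@ler_norm_sum _ (Rcomplex R)). Qed.

Lemma eq_normc_of_shift (d : R) (x : R[i]) :
  0 < d -> d + normc (x - toC d) <= normc x -> x = toC (normc x).
Proof.
move=> d_gt0 shift_le.
have normE (z : R[i]) : `|z| = toC (normc z) by case: z.
have shiftK : toC d + (x - toC d) = x by rewrite addrC subrK.
have normc_split : normc x = d + normc (x - toC d).
  apply/eqP; rewrite eq_le shift_le andbT -{1}shiftK.
  by apply: le_trans (le_normcD _ _) _; rewrite normc_real gtr0_norm.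
have /normCDeq[t _ [dt xt]] :
    `|toC d + (x - toC d)| = `|toC d| + `|x - toC d| :> R[i].
  by rewrite shiftK !normE normc_real gtr0_norm // normc_split rmorphD.
have t1 : t = 1.
  have d_neq0 : toC d != 0 by rewrite fmorph_eq0 gt_eqF.
  by apply: (mulfI d_neq0); rewrite mulr1 {2}dt normE normc_real gtr0_norm.
by rewrite normc_split rmorphD /= -normE -{1}shiftK {1}xt t1 mulr1.
Qed.

Lemma lemx0_abs m n (v : 'M[R[i]]_(m, n)) : lemx 0 (abs v).
Proof. by apply/lemx0P => i j; rewrite mxE normc_ge0. Qed.

Lemma abs_mx_eq0 m n (v : 'M[R[i]]_(m, n)) : (abs v == 0) = (v == 0).
Proof.
apply/eqP/eqP => [v0|->]; apply/matrixP => i j; last by rewrite !mxE normc0.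
by move/matrixP/(_ i j): v0; rewrite !mxE => /eqP; rewrite normc_eq0 => /eqP.
Qed.

Lemma normc_mulmx_le m n p (v : 'M[R[i]]_(m, n)) (B : 'M[R]_(n, p)) i j :
  (forall k, 0 <= B k j) ->
  normc ((v *m map_mx toC B) i j) <= (abs v *m B) i j.
Proof.
move=> B_ge0; rewrite !mxE; apply: le_trans (normc_sum _ _) _.
by apply: ler_sum => k _; rewrite !mxE normcM normc_real ger0_norm.
Qed.

Lemma abs_eigenvector_shift n (A : 'M[R]_n) (d : R) (x : R[i]) (v : 'rV_n) :
  lemx 0 A -> (forall j, d <= A j j \/ col j A = 0) -> x != 0 ->
  v *m map_mx toC A = x *: v ->
  lemx ((d + normc (x - toC d)) *: abs v) (abs v *m A).
Proof.
move=> /lemx0P A_ge0 A_diag x_neq0 vA i j; have [d_le|col0] := A_diag j.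
  have shifted_ge0 k : 0 <= (A - d%:M) k j.
    rewrite !mxE; have [->|_] := eqVneq; first by rewrite mulr1n subr_ge0.
    by rewrite subr0.
  have shifted_v : v *m map_mx toC (A - d%:M) = (x - toC d) *: v.
    by rewrite map_mxB map_scalar_mx mulmxBr vA mul_mx_scalar scalerBl.
  have := normc_mulmx_le v i shifted_ge0.
  rewrite shifted_v mulmxBr mul_mx_scalar.
  by move: (abs v *m A) => absvA; rewrite !mxE normcM; lra.
have absvA_ge0 : 0 <= (abs v *m A) i j.
  by rewrite mxE; apply: sumr_ge0 => k _; rewrite mulr_ge0 // mxE normc_ge0.
have /eqP : x * v i j = 0.
  have /matrixP/(_ i j) := vA; rewrite !mxE => <-; apply: big1 => k _.
  by have /matrixP/(_ k 0) := col0; rewrite !mxE => ->; rewrite mulr0.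
rewrite mulf_eq0 (negPf x_neq0) /= => /eqP vij0.
by move: (abs v *m A) absvA_ge0 => absvA; rewrite !mxE vij0 normc0 mulr0.
Qed.

End ComplexModulus.

Section ComplexSpectrum.
Variables (R : rcfType) (n : nat).
Implicit Type A : 'M[R]_n.+1.

Definition complex_eigenvalue A : pred R[i] := eigenvalue (map_mx toC A).

Lemma complex_eigenvalue_seq A : exists2 s : seq R[i],
  char_poly (map_mx toC A) = \prod_(x <- s) ('X - x%:P) &
  forall x, complex_eigenvalue A x = (x \in s).
Proof.
have [s] := closed_field_poly_normal (char_poly (map_mx toC A)).
rewrite (monicP (char_poly_monic _)) scale1r => charE; exists s => // x.
by rewrite /complex_eigenvalue eigenvalue_root_char charE root_prod_XsubC.
Qed.

Lemma exists_max_eigenvalue A : exists2 x, complex_eigenvalue A x &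
  forall y, complex_eigenvalue A y -> normc y <= normc x.
Proof.
have [s charE eigenE] := complex_eigenvalue_seq A.
have s_gt0 : (0 < size s)%N.
  have := size_char_poly (map_mx toC A).
  by rewrite charE size_prod_XsubC => -[->].
pose modulus (i : 'I_(size s)) := normc s`_i.
have [i _ i_max] :=
  @Order.TotalTheory.arg_maxP _ _ _ (Ordinal s_gt0) xpredT modulus isT.
exists s`_i => [|y]; first by rewrite eigenE mem_nth.
rewrite eigenE => ys; rewrite -(nth_index 0 ys).
by apply: (i_max (Ordinal _)); rewrite ?index_mem.
Qed.

Definition strictly_dominant A (p : R) :=
  forall x, complex_eigenvalue A x -> x != toC p -> normc x < p.

Lemma strictly_dominant_ge A p x : 0 < p ->
  strictly_dominant A p -> complex_eigenvalue A x -> normc x <= p.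
Proof.
move=> p_gt0 p_dom eig_x; have [->|] := eqVneq x (toC p).
  by rewrite normc_real gtr0_norm.
by move=> /(p_dom x eig_x)/ltW.
Qed.

End ComplexSpectrum.

Section IterateDecay.
Variables (R : realType) (n : nat).

Definition iterates_littleo (A : 'M[R[i]]_n.+1) (t : R) (v : 'rV_n.+1) :=
  forall i, (fun k => normc ((v *m A ^+ k) 0 i) / t ^+ k) @ \oo --> (0 : R).

Lemma annihilated_littleo (A : 'M_n.+1) (t : R) (s : seq R[i]) v : 0 < t ->
  {in s, forall x, normc x < t} ->
  v *m horner_mx A (\prod_(x <- s) ('X - x%:P)) = 0 -> iterates_littleo A t v.
Proof.
move=> t_gt0; have tX_ge0 k : 0 <= t ^+ k by rewrite exprn_ge0 // ltW.
elim: s v => [|x s IHs] v s_lt.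
  rewrite big_nil rmorph1 mulmx1 => -> i; apply: cvg_near_cst.
  by apply: nearW => k; rewrite mul0mx mxE normc0 mul0r.
rewrite big_cons rmorphM /= -mulmxE mulmxA; set w := v *m _ => w_ann i.
have w_littleo : iterates_littleo A t w.
  by apply: IHs => // y ys; apply: s_lt; rewrite inE ys orbT.
have vA : v *m A = x *: v + w.
  rewrite /w rmorphB /= horner_mx_X horner_mx_C mulmxBr mul_mx_scalar.
  by rewrite addrC subrK.
have iterS k :
    (v *m A ^+ k.+1) 0 i = x * (v *m A ^+ k) 0 i + (w *m A ^+ k) 0 i.
  by rewrite exprS -mulmxE mulmxA vA mulmxDl -scalemxAl !mxE.
apply: (@cvg0_contraction _ (normc x / t) _
  (fun k => normc ((w *m A ^+ k) 0 i) / t ^+ k / t)).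
- rewrite divr_ge0 ?normc_ge0 ?(ltW t_gt0) //= ltr_pdivrMr // mul1r.
  by rewrite s_lt ?mem_head.
- by move=> k; rewrite divr_ge0 ?normc_ge0.
- move=> k; rewrite iterS mulf_div -[_ / _ / t]mulrA -invfM (mulrC _ t) -exprS.
  by rewrite -mulrDl ler_wpM2r ?invr_ge0 // -normcM le_normcD.
by rewrite -(mul0r t^-1); apply: cvgMr_tmp; exact: w_littleo.
Qed.

Lemma normc_iterate (A : 'M[R]_n.+1) (v : 'rV_n.+1) k i :
  normc ((map_mx toC v *m map_mx toC A ^+ k) 0 i) = `|(v *m A ^+ k) 0 i|.
Proof. by rewrite -rmorphXn -map_mxM mxE normc_real. Qed.

Lemma not_iterates_littleo (A : 'M[R]_n.+1) (u v : 'rV_n.+1) t :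
  lemx 0 A -> lemx 0 u -> u != 0 -> 0 < t -> lemx (t *: u) (u *m A) ->
  lemx u v -> ~ iterates_littleo (map_mx toC A) t (map_mx toC v).
Proof.
move=> A_ge0 u_ge0 /(nneg_row_neq0 u_ge0)[j uj_gt0] t_gt0 tu_le uv v_littleo.
have [N _ ratio_small] := cvgr_lt _ (v_littleo j) _ uj_gt0.
have := ratio_small N (leqnn N); rewrite normc_iterate ltNge => /negP; apply.
rewrite ler_pdivlMr ?exprn_gt0 // mulrC.
have := supereigen_pow N A_ge0 (ltW t_gt0) tu_le uv 0 j; rewrite mxE.
by move=> /le_trans; apply; exact: ler_norm.
Qed.

Lemma exists_eigenvalue_ge (A : 'M[R]_n.+1) (u : 'rV_n.+1) (t : R) :
  lemx 0 A -> lemx 0 u -> u != 0 -> 0 < t -> lemx (t *: u) (u *m A) ->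
  exists2 x, complex_eigenvalue A x & t <= normc x.
Proof.
move=> A_ge0 u_ge0 u_neq0 t_gt0 tu_le.
have [s charE eigenE] := complex_eigenvalue_seq A.
have [/hasP[x xs t_le]|/hasPn s_lt] := boolP (has (fun x => t <= normc x) s).
  by exists x; rewrite // eigenE.
case: (not_iterates_littleo A_ge0 u_ge0 u_neq0 t_gt0 tu_le (v := u)) => //.
apply: (annihilated_littleo t_gt0 (s := s)) => [x /s_lt|].
  by rewrite -ltNge.
by rewrite -charE Cayley_Hamilton mulmx0.
Qed.

End IterateDecay.

Section DominantEigenvalue.
Variables (R : realType) (n : nat).
Implicit Types (A : 'M[R]_n.+1) (v w : 'rV[R]_n.+1) (p : R).

Lemma dominant_splitting A p v : 0 < p -> strictly_dominant A p ->
  exists m w, w *m (A - p%:M) ^+ m = 0 /\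
    iterates_littleo (map_mx toC A) p (map_mx toC (v - w)).
Proof.
move=> p_gt0 p_dom; have [m [q]] := multiplicity_XsubC (char_poly A) p.
rewrite monic_neq0 ?char_poly_monic //= => qp_neq0 charE.
have qp_coprime : coprimep (('X - p%:P) ^+ m) q.
  by rewrite coprimep_expl // coprimep_sym coprimep_XsubC.
have : (v <= kermxpoly A (('X - p%:P) ^+ m * q))%MS.
  by rewrite mulrC -charE; apply/sub_kermxP; rewrite Cayley_Hamilton mulmx0.
rewrite (kermxpolyM _ qp_coprime) => /sub_addsmxP[[w1 w2] /= ->].
exists m, (w1 *m kermxpoly A (('X - p%:P) ^+ m)); split.
  have -> : A - p%:M = horner_mx A ('X - p%:P).
    by rewrite rmorphB /= horner_mx_X horner_mx_C.
  by rewrite -rmorphXn -mulmxA mulmx_ker mulmx0.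
rewrite [_ *m _ + _]addrC addrK.
have [s qE] := closed_field_poly_normal (map_poly toC q).
have lead_q_neq0 : lead_coef (map_poly toC q) != 0.
  rewrite lead_coef_eq0 map_poly_eq0.
  by apply: contraNneq qp_neq0 => ->; rewrite root0.
apply: (annihilated_littleo p_gt0 (s := s)) => [x xs|].
  have qx0 : root (map_poly toC q) x by rewrite qE rootZ // root_prod_XsubC.
  apply: p_dom.
    rewrite /complex_eigenvalue eigenvalue_root_char -map_char_poly charE.
    by rewrite rmorphM rootM qx0.
  by apply: contraNneq qp_neq0 => xp; rewrite -(fmorph_root toC) /= -xp.
apply: (scalerI lead_q_neq0); rewrite scaler0 scalemxAr -linearZ /= -qE.
by rewrite -map_horner_mx -map_mxM -mulmxA mulmx_ker mulmx0 map_mx0.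
Qed.

Lemma jordan_chain_pow A p w D k : (D <= k)%N -> w *m (A - p%:M) ^+ D.+1 = 0 ->
  w *m A ^+ k =
    \sum_(j < D.+1) 'C(k, j)%:R *: (p ^+ (k - j) *: (w *m (A - p%:M) ^+ j)).
Proof.
move=> le_Dk wD; pose N := A - p%:M.
have wN0 j : (D < j)%N -> w *m N ^+ j = 0.
  by move=> lt_Dj; rewrite -(subnKC lt_Dj) exprD -mulmxE mulmxA wD mul0mx.
have {1}-> : A = p%:M + N by rewrite addrC subrK.
rewrite exprDn_comm; last exact: comm_scalar_mx.
pose term j := 'C(k, j)%:R *: (p ^+ (k - j) *: (w *m N ^+ j)).
rewrite mulmx_sumr -/N (big_ord_widen k.+1 term) //.
rewrite [RHS]big_mkcond; apply: eq_bigr => j _ /=.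
rewrite -rmorphXn /= -mulmxE mul_scalar_mx -scaler_nat -!scalemxAr /term.
by case: ltnP => // lt_Dj; rewrite wN0 // !scaler0.
Qed.

Lemma jordan_chain_cvg A p w D : p != 0 -> w *m (A - p%:M) ^+ D.+1 = 0 ->
  forall i, (fun k => (w *m A ^+ k) 0 i / (p ^+ k * 'C(k, D)%:R)) @ \oo -->
    (p ^- D *: (w *m (A - p%:M) ^+ D)) 0 i.
Proof.
move=> p_neq0 wD i; pose z j := p ^- j * (w *m (A - p%:M) ^+ j) 0 i.
have ratio_cvg :
    (fun k => \sum_(j < D.+1) 'C(k, j)%:R / 'C(k, D)%:R * z j) @ \oo -->
    \sum_(j < D.+1) (j == D :> nat)%:R * z j.
  apply: cvg_big => [|j _]; first exact: add_continuous.
  by apply: cvgMr_tmp; apply: cvg_bin_ratio; rewrite -ltnS.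
have limE : \sum_(j < D.+1) (j == D :> nat)%:R * z j = z D.
  rewrite big_ord_recr /= eqxx mul1r big1 ?add0r // => j _.
  by rewrite ltn_eqF ?mul0r.
rewrite mxE -/(z D) -limE; apply: cvg_trans ratio_cvg.
apply: near_eq_cvg; near=> k.
have le_Dk : (D <= k)%N by near: k; exact: nbhs_infty_ge.
rewrite (jordan_chain_pow le_Dk wD) summxE mulr_suml; apply: eq_bigr => j _.
have le_jk : (j <= k)%N by rewrite (leq_trans _ le_Dk) // -ltnS.
rewrite /z; move: (w *m _ ^+ j) => wj; rewrite !mxE exprB ?unitfE //; field.
by rewrite !expf_neq0 // pnatr_eq0 -lt0n bin_gt0 le_Dk.
Unshelve. all: by end_near. Qed.

Lemma jordan_chain_end A p w m : w *m (A - p%:M) ^+ m = 0 -> w != 0 ->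
  exists D, w *m (A - p%:M) ^+ D.+1 = 0 /\ w *m (A - p%:M) ^+ D != 0.
Proof.
move=> w_nil w_neq0; have nil_ex : exists j, w *m (A - p%:M) ^+ j == 0.
  by exists m; apply/eqP.
case: (ex_minnP nil_ex) => [[|D]] /eqP wD D_min.
  by rewrite mulmx1 in wD; rewrite wD eqxx in w_neq0.
by exists D; split=> //; apply/negP => /D_min; rewrite ltnn.
Qed.

Theorem power_iteration_cvg A p v : 0 < p -> strictly_dominant A p ->
  ~ iterates_littleo (map_mx toC A) p (map_mx toC v) ->
  exists D (z : 'rV[R]_n.+1), [/\ z != 0, z *m A = p *: z &
    forall i, (fun k => (v *m A ^+ k) 0 i / (p ^+ k * 'C(k, D)%:R)) @ \oo -->
      z 0 i].
Proof.
move=> p_gt0 p_dom v_large; have p_neq0 : p != 0 by rewrite gt_eqF.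
have [m [w [w_nil rest_littleo]]] := dominant_splitting v p_gt0 p_dom.
have w_neq0 : w != 0.
  by apply: contra_not_neq v_large => w0; rewrite w0 subr0 in rest_littleo.
have [D [wD wD_neq0]] := jordan_chain_end w_nil w_neq0.
exists D, (p ^- D *: (w *m (A - p%:M) ^+ D)); split.
- by rewrite scaler_eq0 invr_eq0 expf_eq0 (negPf p_neq0) andbF.
- rewrite -scalemxAl scalerA mulrC -scalerA; congr (_ *: _).
  have := wD; rewrite exprSr -mulmxE mulmxA mulmxBr mul_mx_scalar.
  by move=> /eqP; rewrite subr_eq0 => /eqP.
move=> i; rewrite -[X in _ --> X]addr0.
have rest_cvg0 : (fun k => ((v - w) *m A ^+ k) 0 i / p ^+ k) @ \oo --> (0 : R).
  apply/norm_cvg0P; apply: cvg_trans (rest_littleo i).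
  apply: near_eq_cvg; apply: nearW => k; rewrite normc_iterate normrM normfV.
  by rewrite (ger0_norm (exprn_ge0 _ (ltW p_gt0))).
have rest_ratio_cvg0 : (fun k => ((v - w) *m A ^+ k) 0 i / p ^+ k *
    ('C(k, 0)%:R / 'C(k, D)%:R)) @ \oo --> (0 : R).
  by rewrite -(mul0r (0 == D)%N%:R); exact: cvgM rest_cvg0 (cvg_bin_ratio _).
have chain_cvg := jordan_chain_cvg p_neq0 wD (i := i).
apply: cvg_trans (cvgD chain_cvg rest_ratio_cvg0).
apply: near_eq_cvg; apply: nearW => k; rewrite fctE /=.
by rewrite bin0 mulmxBl !mxE invfM; ring.
Qed.

End DominantEigenvalue.

Section NonNegativeMatrix.
Variables (R : realType) (n : nat) (A : 'M[R]_n.+1).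
Hypothesis A_ge0 : lemx 0 A.
Hypothesis A_diag : forall j, 0 < A j j \/ col j A = 0.

Lemma diag_lower_bound :
  exists2 d, 0 < d & forall j, d <= A j j \/ col j A = 0.
Proof.
have [d d_gt0 d_le] :=
  exists_pos_lower_bound (f := fun j => A j j) (fun j => id).
by exists d => // j; case: (A_diag j) => [/d_le|]; [left|right].
Qed.

Lemma exists_eigenvalue_neq0 : A != 0 ->
  exists2 x, complex_eigenvalue A x & x != 0.
Proof.
case/matrix0Pn=> i [j Aij_neq0].
have Ajj_gt0 : 0 < A j j.
  case: (A_diag j) => // /matrixP/(_ i 0); rewrite !mxE => /eqP.
  by rewrite (negPf Aij_neq0).
pose ej : 'rV[R]_n.+1 := delta_mx 0 j.
have ej_ge0 : lemx 0 ej by apply/lemx0P => k l; rewrite mxE.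
have ej_neq0 : ej != 0 by apply/rV0Pn; exists j; rewrite mxE !eqxx oner_eq0.
have ej_le : lemx (A j j *: ej) (ej *m A).
  move=> k l; rewrite -rowE !mxE (ord1 k) eqxx /=; have [->|_] := eqVneq.
    by rewrite mulr1.
  by rewrite mulr0; apply: (lemx0P A).1.
have [x eig_x x_ge] := exists_eigenvalue_ge A_ge0 ej_ge0 ej_neq0 Ajj_gt0 ej_le.
by exists x => //; rewrite -normc_eq0 gt_eqF // (lt_le_trans Ajj_gt0).
Qed.

Lemma max_eigenvalue_real x : complex_eigenvalue A x -> x != 0 ->
  (forall y, complex_eigenvalue A y -> normc y <= normc x) ->
  x = toC (normc x) /\
  exists u : 'rV[R]_n.+1,
    [/\ lemx 0 u, u != 0 & lemx (normc x *: u) (u *m A)].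
Proof.
move=> /eigenvalueP[v vA v_neq0] x_neq0 x_max.
have [d d_gt0 d_le] := diag_lower_bound.
have shift_le := abs_eigenvector_shift A_ge0 d_le x_neq0 vA.
have shift_gt0 : 0 < d + normc (x - toC d) by rewrite ltr_wpDr ?normc_ge0.
have absv_ge0 := lemx0_abs v.
have absv_neq0 : abs v != 0 by rewrite abs_mx_eq0.
have [y /x_max y_le shift_le_y] :=
  exists_eigenvalue_ge A_ge0 absv_ge0 absv_neq0 shift_gt0 shift_le.
split; first exact: eq_normc_of_shift d_gt0 (le_trans shift_le_y y_le).
exists (abs v); split=> //.
apply: lemx_trans shift_le => i j; rewrite !mxE ler_wpM2r ?normc_ge0 //.
rewrite -{1}[x](subrK (toC d)) addrC (le_trans (le_normcD _ _)) //.
by rewrite normc_real gtr0_norm.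
Qed.

Lemma exists_strictly_dominant : A != 0 ->
  exists p (u : 'rV[R]_n.+1), [/\ 0 < p, strictly_dominant A p, lemx 0 u,
    u != 0 & lemx (p *: u) (u *m A)].
Proof.
move=> /exists_eigenvalue_neq0[y eig_y y_neq0].
have [x eig_x x_max] := exists_max_eigenvalue A.
have x_gt0 : 0 < normc x.
  apply: lt_le_trans (x_max _ eig_y).
  by rewrite lt0r normc_eq0 y_neq0 normc_ge0.
have x_neq0 : x != 0 by rewrite -normc_eq0 gt_eqF.
have [_ [u [u_ge0 u_neq0 xu_le]]] := max_eigenvalue_real eig_x x_neq0 x_max.
exists (normc x), u; split=> // z eig_z; apply: contraNT.
rewrite -leNgt => x_le_z; have zx : normc z = normc x.
  by apply/le_anti; rewrite x_max.
have z_neq0 : z != 0 by rewrite -normc_eq0 zx gt_eqF.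
have z_max w : complex_eigenvalue A w -> normc w <= normc z.
  by rewrite zx; exact: x_max.
by have [-> _] := max_eigenvalue_real eig_z z_neq0 z_max; rewrite zx.
Qed.

Theorem normalized_power_iteration_cvg (v : 'rV[R]_n.+1) :
  A != 0 -> (forall i, 0 < v 0 i) ->
  exists p (z : 'rV[R]_n.+1),
  [/\ forall i, (fun k => normalize_l1 (v *m A ^+ k) 0 i) @ \oo --> z 0 i,
      z *m A = p *: z,
      forall x, complex_eigenvalue A x -> normc x <= p,
      lemx 0 z &
      \sum_i z 0 i = 1].
Proof.
move=> /exists_strictly_dominant[p [u [p_gt0 p_dom u_ge0 u_neq0 pu_le]]] v_gt0.
have [c c_gt0 cu_le] := exists_scale_le u v_gt0.
have v_large : ~ iterates_littleo (map_mx toC A) p (map_mx toC v).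
  apply: (not_iterates_littleo A_ge0 (u := c *: u)) => //.
  - by rewrite -(scaler0 _ c); apply: lemx_scale => //; exact: ltW.
  - by rewrite scaler_eq0 gt_eqF.
  rewrite -scalemxAl scalerA mulrC -scalerA.
  by apply: lemx_scale => //; exact: ltW.
have [D [z [z_neq0 zA z_cvg]]] := power_iteration_cvg p_gt0 p_dom v_large.
pose g k := p ^+ k * 'C(k, D)%:R.
have g_gt0 : \forall k \near \oo, 0 < g k.
  near=> k; rewrite mulr_gt0 ?exprn_gt0 // ltr0n bin_gt0.
  by near: k; exact: nbhs_infty_ge.
have v_ge0 : lemx 0 v by apply/lemx0P => i j; rewrite (ord1 i) ltW.
have z_ge0 : lemx 0 z.
  apply/lemx0P => i j; rewrite (ord1 i); apply: cvgr_to_ge (z_cvg j) _.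
  apply: filterS g_gt0 => k gk_gt0; rewrite divr_ge0 ?(ltW gk_gt0) //.
  by apply: (lemx0P _).1; exact: lemx0_mul_pow.
exists p, (normalize_l1 z); split.
- move=> i; have scaled_cvg j :
      (fun k => ((g k)^-1 *: (v *m A ^+ k)) 0 j) @ \oo --> z 0 j.
    by under eq_cvg do rewrite mxE mulrC; exact: z_cvg.
  apply: cvg_trans (cvg_normalize_l1 z_neq0 scaled_cvg (i := i)).
  apply: near_eq_cvg; apply: filterS g_gt0 => k gk_gt0.
  by rewrite normalize_l1Z ?invr_gt0.
- by rewrite -scalemxAl zA scalerA mulrC -scalerA.
- by move=> x; exact: strictly_dominant_ge.
- exact: normalize_l1_ge0.
- exact: sum_normalize_l1.
Unshelve. all: by end_near. Qed.

End NonNegativeMatrix.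

Section NatIndexed.
Import Rstruct.
Local Notation R := Rdefinitions.R.
Implicit Types (A B : nat -> nat -> R) (v : nat -> R).

Lemma sumRE d v : sumR d v = \sum_(i < d) v i.
Proof. by elim: d => [|d IHd] /=; rewrite ?big_ord0 // big_ord_recr /= IHd. Qed.

Definition row_of d v : 'rV[R]_d := \row_i v i.

(* Transposed: the matrix [A] acts on columns, [mx_of d A] on rows. *)
Definition mx_of d A : 'M[R]_d := \matrix_(i, j) A j i.

Lemma row_ofE d v i (lt_id : (i < d)%N) : row_of d v 0 (Ordinal lt_id) = v i.
Proof. by rewrite mxE. Qed.

Lemma row_of_surj d (w : 'rV[R]_d) : exists v, row_of d v = w.
Proof.
exists (fun i => oapp (w 0) 0 (insub i)).
by apply/rowP => i; rewrite mxE valK.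
Qed.

Lemma row_of_matvec d A v : row_of d (matvec d A v) = row_of d v *m mx_of d A.
Proof.
apply/rowP => i; rewrite !mxE /matvec sumRE; apply: eq_bigr => j _.
by rewrite !mxE mulrC.
Qed.

Lemma row_of_matpowvec n A v k :
  row_of n.+1 (matpowvec n.+1 A k v) = row_of n.+1 v *m mx_of n.+1 A ^+ k.
Proof.
elim: k => [|k IHk]; first by rewrite mulmx1.
by rewrite row_of_matvec IHk exprSr -mulmxE mulmxA.
Qed.

Lemma row_of_normalize1 d v :
  row_of d (normalize1 d v) = normalize_l1 (row_of d v).
Proof.
apply/rowP => i; rewrite !mxE /normalize1 sumRE mulrC RdivE.
by congr (_ / _); apply: eq_bigr => j _; rewrite RabsE mxE.
Qed.

Lemma cvg_Un_cv (u : nat -> R) (l : R) :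
  u @ \oo --> (l : (R : realType)) -> Un_cv u l.
Proof.
move=> u_cvg e /RltP e_gt0.
have /(_ _ e e_gt0)[N _ u_near] :=
  (@cvgrPdist_lt _ (R : realType) _ _ _ u l).1 u_cvg.
exists N => k /ssrnat.leP le_Nk; apply/RltP; rewrite RdistE distrC.
exact: u_near.
Qed.

Lemma complex_eigenvalue_mx_of n A a b : is_eigenvalueC n.+1 A a b ->
  complex_eigenvalue (mx_of n.+1 A) (a +i* b)%C.
Proof.
move=> [u [v [[i [/ssrnat.ltP lt_in uv_neq0]] uvA]]].
pose U := row_of n.+1 u; pose V := row_of n.+1 v.
have [UA VA] : U *m mx_of n.+1 A = a *: U - b *: V /\
               V *m mx_of n.+1 A = b *: U + a *: V.
  rewrite -!row_of_matvec; split; apply/rowP => j; rewrite !mxE;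
    by case: (uvA j (elimT ssrnat.ltP (ltn_ord j))).
pose w : 'rV[R[i]]_n.+1 := map_mx toC U + 'i%C *: map_mx toC V.
have wE j : w 0 j = (u j +i* v j)%C by rewrite !mxE; simpc.
apply/eigenvalueP; exists w.
  rewrite mulmxDl -scalemxAl -!map_mxM UA VA.
  apply/rowP => j; rewrite [in RHS]mxE wE !mxE; simpc.
  by rewrite [b * _ + _]addrC.
apply/eqP => /rowP/(_ (Ordinal lt_in)); rewrite wE mxE => -[u0 v0].
by case: uv_neq0.
Qed.

Lemma principal_eigenvector_row_of n A z (p : R) :
  row_of n.+1 z != 0 -> row_of n.+1 z *m mx_of n.+1 A = p *: row_of n.+1 z ->
  (forall x, complex_eigenvalue (mx_of n.+1 A) x -> normc x <= p) ->
  principal_eigenvector n.+1 A z.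
Proof.
move=> /rV0Pn[j]; rewrite mxE => /eqP zj_neq0 zA p_max.
exists p; split; last split.
- by exists j; split=> //; apply/ssrnat.ltP.
- move=> i /ssrnat.ltP lt_in; rewrite -(row_ofE _ lt_in) row_of_matvec zA.
  by rewrite mxE row_ofE.
move=> a b /complex_eigenvalue_mx_of/p_max modulus_le; apply/RleP.
by rewrite RabsE RsqrtE; apply: le_trans (ler_norm p).
Qed.

Lemma exists_score_limit d A : lemx 0 (mx_of d A) ->
  (forall j, 0 < mx_of d A j j \/ col j (mx_of d A) = 0) -> mx_of d A != 0 ->
  exists z, score_limit d A z.
Proof.
case: d => [|n] A_ge0 A_diag A_neq0.
  by rewrite [mx_of _ _]flatmx0 eqxx in A_neq0.
have ones_gt0 i : 0 < row_of n.+1 ones 0 i by rewrite mxE ltr01.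
have [p [w]] := normalized_power_iteration_cvg A_ge0 A_diag A_neq0 ones_gt0.
have [z <-] := row_of_surj w => -[z_cvg zA p_max z_ge0 sum_z].
have z_neq0 : row_of n.+1 z != 0.
  apply: contra_eq_neq sum_z => ->; rewrite big1 => [|i _]; last by rewrite mxE.
  by rewrite eq_sym oner_eq0.
exists z; split; last split.
- move=> i /ssrnat.ltP lt_in; apply: cvg_Un_cv; rewrite -(row_ofE z lt_in).
  under eq_cvg do rewrite -(row_ofE _ lt_in) row_of_normalize1 row_of_matpowvec.
  exact: z_cvg.
- exact: principal_eigenvector_row_of z_neq0 zA p_max.
split=> [i /ssrnat.ltP lt_in|].
  by apply/RleP; rewrite -(row_ofE z lt_in); exact: (lemx0P _).1.
by rewrite sumRE -[RHS]sum_z; apply: eq_bigr => i _; rewrite mxE.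
Qed.

Lemma matmulE d A B i k : matmul d A B i k = \sum_(j < d) A i j * B j k.
Proof. exact: sumRE. Qed.

Lemma matmul_ge0 d A B i k : (forall j, 0 <= A i j) -> (forall j, 0 <= B j k) ->
  0 <= matmul d A B i k.
Proof.
by move=> A_ge0 B_ge0; rewrite matmulE sumr_ge0 // => j _; rewrite mulr_ge0.
Qed.

Lemma matmul_gt0 d A B i j k :
  (forall l, 0 <= A i l) -> (forall l, 0 <= B l k) -> (j < d)%N ->
  0 < A i j -> 0 < B j k -> 0 < matmul d A B i k.
Proof.
move=> A_ge0 B_ge0 lt_jd Aij_gt0 Bjk_gt0; rewrite matmulE.
rewrite (bigD1 (Ordinal lt_jd)) //= ltr_pwDl ?mulr_gt0 //.
by apply: sumr_ge0 => l _; rewrite mulr_ge0.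
Qed.

Lemma matmul_eq0 d A B i k : (forall j, (j < d)%N -> A i j = 0) ->
  matmul d A B i k = 0.
Proof. by move=> Ai0; rewrite matmulE big1 // => j _; rewrite Ai0 // mul0r. Qed.

Lemma b2RE (b : bool) : b2R b = b%:R.
Proof. by case: b. Qed.

Section CitationMatrices.
Variables (m n : nat) (Mb Cb : nat -> nat -> bool).
Local Notation W := (Wmat m Mb).
Local Notation MT := (MTmat Mb).
Local Notation ICT := (ICTmat Cb).
Local Notation P := (Pmat m n Mb Cb).
Local Notation Q := (Qmat m n Mb Cb).

Lemma WmatE i j : W i j = (Mb i j)%:R / \sum_(l < m) (Mb l j)%:R.
Proof.
by rewrite /Wmat RdivE sumRE b2RE; under [in RHS]eq_bigr do rewrite -b2RE.
Qed.

Lemma Wmat_ge0 i j : 0 <= W i j.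
Proof. by rewrite WmatE divr_ge0 ?sumr_ge0. Qed.

Lemma Wmat_gt0 i j : (i < m)%N -> Mb i j -> 0 < W i j.
Proof.
move=> lt_im Mij; rewrite WmatE Mij divr_gt0 // (bigD1 (Ordinal lt_im)) //=.
by rewrite Mij ltr_pwDl ?sumr_ge0.
Qed.

Lemma MTmat_ge0 j i : 0 <= MT j i.
Proof. by rewrite /MTmat b2RE. Qed.

Lemma MTmat_gt0 j i : Mb i j -> 0 < MT j i.
Proof. by move=> Mij; rewrite /MTmat b2RE Mij. Qed.

Lemma ICTmatE j k : ICT j k = (j == k)%:R + (Cb k j)%:R.
Proof.
rewrite /ICTmat b2RE.
by case: eqVneq => [->|/eqP/Nat.eqb_neq ->]; rewrite ?Nat.eqb_refl.
Qed.

Lemma ICTmat_ge0 j k : 0 <= ICT j k.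
Proof. by rewrite ICTmatE addr_ge0. Qed.

Lemma ICTmat_diag_gt0 j : 0 < ICT j j.
Proof. by rewrite ICTmatE eqxx ltr_pwDl. Qed.

Lemma WICT_ge0 i j : 0 <= matmul n W ICT i j.
Proof. by apply: matmul_ge0 => k; [exact: Wmat_ge0|exact: ICTmat_ge0]. Qed.

Lemma ICTMT_ge0 j i : 0 <= matmul n ICT MT j i.
Proof. by apply: matmul_ge0 => k; [exact: ICTmat_ge0|exact: MTmat_ge0]. Qed.

Lemma Pmat_ge0 i k : 0 <= P i k.
Proof. by apply: matmul_ge0 => j; [exact: WICT_ge0|exact: MTmat_ge0]. Qed.

Lemma Qmat_ge0 j k : 0 <= Q j k.
Proof. by apply: matmul_ge0 => i; [exact: ICTMT_ge0|exact: Wmat_ge0]. Qed.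

Lemma Pmat_diag_gt0 i j : (i < m)%N -> (j < n)%N -> Mb i j -> 0 < P i i.
Proof.
move=> lt_im lt_jn Mij.
have WICT_gt0 : 0 < matmul n W ICT i j.
  exact: matmul_gt0 (Wmat_ge0 i) (ICTmat_ge0^~ j) lt_jn (Wmat_gt0 lt_im Mij)
    (ICTmat_diag_gt0 j).
exact: matmul_gt0 (WICT_ge0 i) (MTmat_ge0^~ i) lt_jn WICT_gt0 (MTmat_gt0 Mij).
Qed.

Lemma Qmat_diag_gt0 i j : (i < m)%N -> (j < n)%N -> Mb i j -> 0 < Q j j.
Proof.
move=> lt_im lt_jn Mij.
have ICTMT_gt0 : 0 < matmul n ICT MT j i.
  exact: matmul_gt0 (ICTmat_ge0 j) (MTmat_ge0^~ i) lt_jn (ICTmat_diag_gt0 j)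
    (MTmat_gt0 Mij).
exact: matmul_gt0 (ICTMT_ge0 j) (Wmat_ge0^~ j) lt_im ICTMT_gt0
  (Wmat_gt0 lt_im Mij).
Qed.

Lemma Pmat_row0 i k : (forall j, (j < n)%N -> ~~ Mb i j) -> P i k = 0.
Proof.
move=> no_paper; apply: matmul_eq0 => l _; apply: matmul_eq0 => j lt_jn.
by rewrite WmatE (negPf (no_paper j lt_jn)) mul0r.
Qed.

Hypothesis n_gt0 : (0 < n)%coq_nat.
Hypothesis authors : has_authors m n Mb.

Lemma exists_author j : (j < n)%N -> exists2 i, (i < m)%N & Mb i j.
Proof. by move=> /ssrnat.ltP/authors[i [/ssrnat.ltP lt_im Mij]]; exists i. Qed.

Lemma exists_author_scores : exists x, score_limit m P x.
Proof.
have lt_0n : (0 < n)%N by apply/ssrnat.ltP.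
apply: exists_score_limit.
- by apply/lemx0P => i k; rewrite mxE Pmat_ge0.
- move=> i; have [/existsP[j Mij]|no_paper] := boolP [exists j : 'I_n, Mb i j].
    by left; rewrite mxE; exact: Pmat_diag_gt0 (ltn_ord j) Mij.
  right; apply/colP => k; rewrite !mxE; apply: Pmat_row0 => j lt_jn.
  by move/existsPn: no_paper => /(_ (Ordinal lt_jn)).
have [i lt_im Mi0] := exists_author lt_0n.
apply/matrix0Pn; exists (Ordinal lt_im), (Ordinal lt_im); rewrite mxE.
by rewrite gt_eqF // (Pmat_diag_gt0 lt_im lt_0n Mi0).
Qed.

Lemma exists_paper_scores : exists y, score_limit n Q y.
Proof.
have lt_0n : (0 < n)%N by apply/ssrnat.ltP.
have Q_diag_gt0 j : (j < n)%N -> 0 < Q j j.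
  move=> lt_jn; have [i lt_im Mij] := exists_author lt_jn.
  exact: Qmat_diag_gt0 Mij.
apply: exists_score_limit.
- by apply/lemx0P => j k; rewrite mxE Qmat_ge0.
- by move=> j; left; rewrite mxE Q_diag_gt0.
apply/matrix0Pn; exists (Ordinal lt_0n), (Ordinal lt_0n); rewrite mxE.
by rewrite gt_eqF // Q_diag_gt0.
Qed.

End CitationMatrices.
End NatIndexed.
End PowerIteration.

Theorem theorem1 (m n : nat) (Mb Cb : nat -> nat -> bool)
  (Hn : (0 < n)%nat)
  (Hauth : forall j, (j < n)%nat -> exists i, (i < m)%nat /\ Mb i j = true)
  (Hacyc : acyclic n Cb) :
  exists xstar ystar : nat -> R,
    (forall i, (i < m)%nat -> Un_cv (fun k => xseq m n Mb Cb k i) (xstar i)) /\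
    (forall j, (j < n)%nat -> Un_cv (fun k => yseq m n Mb Cb k j) (ystar j)) /\
    principal_eigenvector m (Pmat m n Mb Cb) xstar /\
    principal_eigenvector n (Qmat m n Mb Cb) ystar /\
    (forall i, (i < m)%nat -> 0 <= xstar i) /\
    (forall j, (j < n)%nat -> 0 <= ystar j) /\
    sumR m xstar = 1 /\ sumR n ystar = 1.
Proof.
have [x [x_cvg [x_principal [x_ge0 sum_x]]]] :=
  PowerIteration.exists_author_scores Cb Hn Hauth.
have [y [y_cvg [y_principal [y_ge0 sum_y]]]] :=
  PowerIteration.exists_paper_scores Cb Hn Hauth.
by exists x, y; do 7?split.
Qed.
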